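(* Let $n\in\mathbb{N}$ and let $\mathcal{C}\subseteq\{0,1\}^n$ be a nonempty class. The smallest VC dimension $\overline{d}$ of the intersection closure of $\mathcal{C}$, over all choices of origin $o\in\{0,1\}^n$, equals the smallest integer $k\ge 0$ for which $\mathcal{C}$ satisfies the $k$-close cube condition.
   Context: $[n]=\{1,\dots,n\}$. For $u^1,\dots,u^k\in\{0,1\}^n$, $u^1\odot\cdots\odot u^k$ denotes the coordinatewise product. The intersection closure of $\mathcal{C}$ is $\overline{\mathcal{C}}=\{u^1\odot\cdots\odot u^k: 1\le k\le n,\ \{u^1,\dots,u^k\}\subseteq\mathcal{C}\}$. Choosing the origin to be $o\in\{0,1\}^n$ means relabelling coordinates so that $o$ becomes the zero vector, i.e. replacing $\mathcal{C}$ by $\mathcal{C}\oplus o=\{v\oplus o: v\in\mathcal{C}\}$ ($\oplus$ is coordinatewise addition mod 2) before taking the intersection closure. $\mathcal{C}$ shatters $I\subseteq[n]$ if the coordinate projection of $\mathcal{C}$ to $\{0,1\}^I$ is onto; the VC dimension is the maximum of $|I|$ over shattered $I$. A cube with colour set $I\subseteq[n]$ is a set of all points of $\{0,1\}^n$ having prescribed values on $[n]\setminus I$; it is an $|I|$-cube. A set of $e$-cubes is complete if it consists of exactly $\binom{n}{e}$ cubes, one with colour set $I$ for each $I\subseteq[n]$ with $|I|=e$. $\mathcal{C}$ satisfies the $k$-close cube condition if there are a vertex $v\in\{0,1\}^n$ and a complete set of $(n-k-1)$-cubes, all contained in the complement $\{0,1\}^n\setminus\mathcal{C}$, such that each of these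 cubes is at Hamming distance at most one from $v$ (i.e. contains a point at Hamming distance at most $1$ from $v$). For $k=n$ the condition holds vacuously. *)

(* Defs.v *)
From mathcomp Require Import all_boot.
Set Implicit Arguments.
Unset Strict Implicit.
Unset Printing Implicit Defensive.

Section Classes.
Variable n : nat.

Definition point := {ffun 'I_n -> bool}.

Implicit Types (C Q : {set point}) (I : {set 'I_n}) (u v o : point).

Definition xor_point u v : point := [ffun i => u i (+) v i].

Definition prod_point k (u : {ffun 'I_k -> point}) : point :=
  [ffun i => \big[andb/true]_(j < k) u j i].

Definition change_origin o C : {set point} := [set xor_point v o | v in C].

(* [k : 'I_n] ranges over 0..n-1, so the number [k.+1] of factors ranges over
   1..n; the factors need not be distinct. For [n = 0] there is no admissible
   number of factors and the closure is empty. *)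
Definition intersection_closure C : {set point} :=
  [set x | [exists k : 'I_n, exists u : {ffun 'I_k.+1 -> point},
              [forall j, u j \in C] && (x == prod_point u)]].

Definition projection I u : {ffun {i : 'I_n | i \in I} -> bool} :=
  [ffun i => u (val i)].

Definition shatters C I : bool := [set projection I u | u in C] == [set: _].

(* A nonempty class shatters the empty set; for the empty class, which shatters
   nothing, the maximum is 0 by convention. *)
Definition vc_dim C : nat := \max_(I : {set 'I_n} | shatters C I) #|I|.

Definition closure_vc_dim C o : nat :=
  vc_dim (intersection_closure (change_origin o C)).

(* The origin [ [ffun=> false] ] only witnesses that the set of origins over
   which the minimum is taken is nonempty. *)
Definition min_closure_vc_dim C : nat :=
  closure_vc_dim C
    [arg min_(o < ([ffun=> false] : point)) closure_vc_dim C o].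

Definition hamming_dist u v : nat := #|[set i | u i != v i]|.

Definition is_cube I Q : Prop :=
  exists a : point, Q = [set x : point | [forall i, (i \notin I) ==> (x i == a i)]].

Definition complete_cubes (e : nat) (S : {set {set point}}) : Prop :=
  [/\ #|S| = 'C(n, e),
      forall Q, Q \in S -> exists2 I : {set 'I_n}, #|I| = e & is_cube I Q
    & forall I : {set 'I_n}, #|I| = e -> exists! Q, Q \in S /\ is_cube I Q].

(* The guard makes the condition vacuous at [k = n], where the dimension
   n - k - 1 of the cubes would be -1, and keeps the subtraction on [nat]
   from truncating. *)
Definition close_cube_condition C (k : nat) : Prop :=
  k < n ->
  exists v : point, exists2 S : {set {set point}},
    complete_cubes (n - k - 1) S &
    forall Q, Q \in S ->
      Q \subset ~: C /\ (exists2 x, x \in Q & hamming_dist x v <= 1).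

End Classes.

Definition is_least (P : nat -> Prop) (m : nat) : Prop :=
  P m /\ (forall k, P k -> m <= k).

(* Main.v *)
(** Fix an origin [o] and put [v := ~ o], the all-ones vector after relabelling.
    The intersection closure shatters a nonempty [I] iff the class itself
    realises on [I] every pattern that differs from [v] in at most one place:
    a pattern with at most one zero is a product only if it is already one of
    the factors up to coordinates outside [I], and conversely every pattern is a
    product of patterns with at most one zero. A missing pattern on [I] is a
    cube with colour set [~: I] in the complement of the class, so "no [I] of
    size [k + 1] is shattered" is the [k]-close cube condition at [v]. *)

Require Import Defs.
From mathcomp Require Import all_boot.

Set Implicit Arguments.
Unset Strict Implicit.
Unset Printing Implicit Defensive.

Section Shattering.
Variable n : nat.
Implicit Types (C : {set point n}) (I J : {set 'I_n}).

(** Patterns on [I] are represented by full points read on [I] only, which keeps the dependent type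
    of [projection] out of later arguments. *)
Lemma shattersP C I :
  reflect (forall a : point n, exists2 u, u \in C & {in I, u =1 a})
          (shatters C I).
Proof.
apply: (iffP eqP) => [CI a | CI].
  have : projection I a \in [set projection I u | u in C] by rewrite CI inE.
  case/imsetP=> u uC /ffunP au; exists u => // i iI.
  by have := au (Sub i iI); rewrite !ffunE.
apply/setP=> f; rewrite inE; apply/imsetP.
have [u uC uf] := CI [ffun i => if insub i is Some s then f s else true].
exists u => //; apply/ffunP=> s.
by rewrite ffunE uf ?(valP s) // ffunE valK.
Qed.

Lemma shatters_sub C I J : J \subset I -> shatters C I -> shatters C J.
Proof.
move=> /subsetP JI /shattersP CI; apply/shattersP=> a.
by have [u uC ua] := CI a; exists u => // i /JI /ua.
Qed.

Lemma subset_of_card I k :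
  k <= #|I| -> exists2 J : {set 'I_n}, J \subset I & #|J| = k.
Proof.
move=> kI; have : 0 < #|[set J : {set 'I_n} | J \subset I & #|J| == k]|.
  by rewrite cards_draws bin_gt0.
by case/card_gt0P=> J; rewrite inE => /andP[JI /eqP Jk]; exists J.
Qed.

(** Shattering passes to subsets, so a shattered set with more than [k] elements contains one of
    size exactly [k.+1]. *)
Lemma vc_dim_leP C k :
  reflect (forall I, #|I| = k.+1 -> ~~ shatters C I) (vc_dim C <= k).
Proof.
apply: (iffP (bigmax_leqP _ _ _)) => [CI I Ik | CI I sI].
  by apply/negP=> /CI; rewrite Ik ltnn.
rewrite leqNgt; apply/negP=> /subset_of_card[J JI /CI /negP]; apply.
exact: shatters_sub sI.
Qed.

Lemma vc_dim_le C : vc_dim C <= n.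
Proof. by apply/bigmax_leqP=> I _; rewrite -[leqRHS]card_ord max_card. Qed.

End Shattering.

Section Cubes.
Variable n : nat.
Implicit Types (C Q : {set point n}) (I : {set 'I_n}) (a u v o x : point n).

Definition neg_point v : point n := [ffun i => ~~ v i].

Lemma neg_pointK : involutive neg_point.
Proof. by move=> v; apply/ffunP=> i; rewrite !ffunE negbK. Qed.

Definition cube I a : {set point n} :=
  [set x : point n | [forall i, (i \notin I) ==> (x i == a i)]].

Lemma in_cubeC I a x : reflect {in I, x =1 a} (x \in cube (~: I) a).
Proof.
rewrite inE; apply: (iffP forall_inP) => xa i.
  by move=> iI; apply/eqP/xa; rewrite inE negbK.
by rewrite inE negbK => /xa ->.
Qed.

Lemma cube_id I a : a \in cube I a.
Proof. by rewrite inE; apply/forall_inP. Qed.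

(** Flipping a coordinate of [I] in a base point stays in [Q], whereas a coordinate outside [J] is
    constant on [Q]. *)
Lemma is_cube_color_sub I J Q : is_cube I Q -> is_cube J Q -> I \subset J.
Proof.
move=> [a Qa] [b Qb]; apply/subsetP=> i iI; apply: contraT => iJ.
have /= aQ : a \in Q by rewrite Qa (cube_id I).
have : ([ffun j => a j (+) (j == i)] : point n) \in Q.
  rewrite Qa inE; apply/forall_inP=> j; rewrite ffunE.
  by case: (eqVneq j i) => [-> | _ _]; rewrite ?iI ?addbF.
move: aQ; rewrite Qb !inE => /forall_inP/(_ i iJ)/eqP ab.
by move/forall_inP/(_ i iJ); rewrite ffunE eqxx -ab; case: (a i).
Qed.

Lemma is_cube_color_inj I J Q : is_cube I Q -> is_cube J Q -> I = J.
Proof.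
by move=> QI QJ; apply/eqP; rewrite eqEsubset !(is_cube_color_sub _ _ (Q := Q)).
Qed.

(** A cube determines its colour set, so however the base points are chosen, distinct colour sets
    give distinct cubes. *)
Lemma complete_cubes_imset e (a : {set 'I_n} -> point n) :
  complete_cubes e [set cube I (a I) | I in [set I : {set 'I_n} | #|I| == e]].
Proof.
have cubeP I : is_cube I (cube I (a I)) by exists (a I).
split=> [| _ /imsetP[I + ->] | I Ie].
- rewrite card_in_imset => [|I J _ _ eqIJ]; first by rewrite card_draws card_ord.
  by apply: (is_cube_color_inj (cubeP I)); rewrite eqIJ.
- by rewrite inE => /eqP Ie; exists I.
exists (cube I (a I)); split; first (split=> //).
  by apply/imsetP; exists I; rewrite // inE Ie.
by move=> _ [/imsetP[J _ ->] /is_cube_color_inj/(_ (cubeP J)) ->].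
Qed.

Lemma hamming_dist_le1P u v :
  reflect (forall i j, u i != v i -> u j != v j -> i = j)
          (hamming_dist u v <= 1).
Proof.
apply: (iffP card_le1_eqP) => uv i j; first by move=> ui uj; apply: uv; rewrite inE.
by rewrite !inE => ui uj; apply: uv.
Qed.

End Cubes.

Lemma in_intersection_closure n (C : {set point n}) (x : point n) :
  reflect (exists k : 'I_n, exists2 u : {ffun 'I_k.+1 -> point n},
             forall j, u j \in C & forall i, x i = [forall j, u j i])
          (x \in intersection_closure C).
Proof.
have prodE k (u : {ffun 'I_k -> point n}) i :
    prod_point u i = [forall j, u j i] by rewrite ffunE big_andE.
rewrite inE; apply: (iffP existsP) => -[k].
  case/existsP=> u /andP[/forallP uC /eqP ->].
  by exists k, u => // i; rewrite prodE.
case=> u uC xE; exists k; apply/existsP; exists u.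
rewrite (introT forallP uC); apply/eqP/ffunP=> i.
by rewrite prodE xE.
Qed.

Lemma in_change_origin n (o : point n) C (x : point n) :
  (x \in change_origin o C) = (xor_point x o \in C).
Proof.
have xorK : involutive (fun y : point n => xor_point y o).
  by move=> y; apply/ffunP=> i; rewrite !ffunE addbK.
by rewrite /change_origin (can_imset_pre _ xorK) inE.
Qed.

Lemma shatters_closureP n (C : {set point n}) o (I : {set 'I_n}) :
  I != set0 ->
  reflect (forall a, hamming_dist a (neg_point o) <= 1 ->
             exists2 u, u \in C & {in I, u =1 a})
          (shatters (intersection_closure (change_origin o C)) I).
Proof.
move=> I0; apply: (iffP (shattersP _ _)) => [CI a /hamming_dist_le1P a1 | CI g].
  have [x /in_intersection_closure[k [u uC xE]] xa] := CI (xor_point a o).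
  have {}uC j : xor_point (u j) o \in C by rewrite -in_change_origin.
  (* If the shifted pattern has a zero [i] in [I], some factor vanishes at [i]. The distance bound
     makes [i] the only zero, so every factor is 1 on the rest of [I], and this factor alone
     realises [a]. *)
  have [/exists_inP[i iI ai] | /exists_inPn aI] := boolP [exists i in I, a i == o i].
    have /forallPn[j uji] : ~~ [forall j, u j i].
      by rewrite -xE xa // ffunE (eqP ai) addbb.
    exists (xor_point (u j) o) => // i' i'I; rewrite ffunE.
    have [-> | ni] := eqVneq i' i; first by rewrite (negbTE uji) (eqP ai).
    have ai' : a i' != o i'.
      apply: contraNneq ni => ai'; apply/eqP/a1; rewrite ffunE ?ai' ?(eqP ai).
        by case: (o i').
      by case: (o i).
    have := xE i'; rewrite xa // ffunE.
    have -> : a i' (+) o i' by move: ai'; case: (a i'); case: (o i').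
    by move/esym/forallP/(_ j) ->; move: ai'; case: (a i'); case: (o i').
  (* Without zeros on [I], every factor is 1 there, so any factor will do. *)
  exists (xor_point (u ord0) o) => // i iI; have ai := aI _ iI; rewrite ffunE.
  have := xE i; rewrite xa // ffunE.
  have -> : a i (+) o i by move: ai; case: (a i); case: (o i).
  by move/esym/forallP/(_ ord0) ->; move: ai; case: (a i); case: (o i).
(* A product of [n] factors is admissible only for positive [n]; nonemptiness of [I] excludes
   [n = 0]. *)
case: n => [|n] in C o I I0 CI g *.
  by case/set0Pn: I0 => -[].
(* One factor per coordinate: the factor [i] vanishes on [I] exactly at [i] if
   [g i] is [0], and is [1] on all of [I] otherwise. *)
pose a i : point n.+1 := [ffun j => ~~ o j (+) ((j == i) && ~~ g i)].
have /fin_all_exists2[c cC ca] i : exists2 u, u \in C & {in I, u =1 a i}.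
  apply: CI; apply/hamming_dist_le1P=> j j'; rewrite !ffunE.
  case: (eqVneq j i) => [-> | _]; last by rewrite addbF eqxx.
  by case: (eqVneq j' i) => [-> | _] //; rewrite addbF eqxx.
pose u : {ffun 'I_n.+1 -> point n.+1} := [ffun i => xor_point (c i) o].
exists [ffun i => [forall j, u j i]] => [|i iI].
  apply/in_intersection_closure; exists ord_max, u => i; last by rewrite ffunE.
  rewrite in_change_origin ffunE; congr (_ \in C): (cC i).
  by apply/ffunP=> j; rewrite !ffunE addbK.
have uE j : u j i = ~~ ((i == j) && ~~ g j).
  by rewrite !ffunE ca // ffunE addbAC addNb addbb.
rewrite ffunE; apply/forallP/idP => [/(_ i) | gi j].
  by rewrite uE eqxx negbK.
by rewrite uE; case: eqVneq => // <-; rewrite gi.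
Qed.

Lemma shatters_closurePn n (C : {set point n}) o (I : {set 'I_n}) :
  I != set0 ->
  reflect (exists2 a, hamming_dist a (neg_point o) <= 1
             & cube (~: I) a \subset ~: C)
          (~~ shatters (intersection_closure (change_origin o C)) I).
Proof.
move=> I0; apply: (iffP negP) => [nsI | [a a1 /subsetP aC] /shatters_closureP].
  apply/exists_inP; apply: contra_notT nsI => /exists_inPn nC.
  apply/shatters_closureP=> // a a1; have /subsetPn[u ua] := nC a a1.
  by rewrite inE negbK => uC; exists u => //; apply/in_cubeC.
by case/(_ I0 a a1)=> u uC /in_cubeC/aC; rewrite inE uC.
Qed.

Lemma close_cubeP n (C : {set point n}) k :
  close_cube_condition C k <-> exists o, closure_vc_dim C o <= k.
Proof.
(* For [n <= k] both sides hold: the left by its guard, the right because no VC dimension exceeds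
   [n]. *)
have [nk | kn] := leqP n k.
  split=> [_ | _]; last by rewrite /close_cube_condition ltnNge nk.
  by exists [ffun=> false]; apply: leq_trans nk; apply: vc_dim_le.
have nz (I : {set 'I_n}) : #|I| = k.+1 -> I != set0 by rewrite -card_gt0 => ->.
have cardC (I : {set 'I_n}) : #|~: I| = n - #|I|.
  by rewrite cardsCs setCK card_ord.
split=> [/(_ kn)[v [S [_ _ Sex] SC]] | [o /vc_dim_leP oC] _].
  exists (neg_point v); apply/vc_dim_leP=> I Ik.
  apply/(shatters_closurePn _ _ (nz _ Ik)); rewrite neg_pointK.
  have [|Q [[QS [b Qb]] _]] := Sex (~: I).
    by rewrite cardC Ik -subnDA addn1.
  (* The cube is rebased at its point [x] close to [v], which becomes the missing pattern. *)
  have [QC [x xQ x1]] := SC Q QS; exists x => //.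
  apply: subset_trans QC; rewrite Qb; move: xQ; rewrite Qb => /in_cubeC xb.
  by apply/subsetP=> y /in_cubeC yx; apply/in_cubeC=> i iI; rewrite yx ?xb.
(* Choice needs a value for every [J]; [o] is a dummy for sets of the wrong size. *)
have /fin_all_exists[a aP] (J : {set 'I_n}) : exists a, #|J| == n - k - 1 ->
    hamming_dist a (neg_point o) <= 1 /\ cube J a \subset ~: C.
  have [/eqP Jk | _] := boolP (_ == _); last by exists o.
  have Ik : #|~: J| = k.+1 by rewrite cardC Jk -subnDA addn1 subKn.
  have /(shatters_closurePn _ _ (nz _ Ik))[a a1] := oC _ Ik.
  by rewrite setCK; exists a.
exists (neg_point o), [set cube J (a J) | J in [set J : {set 'I_n} | #|J| == n - k - 1]].
  exact: complete_cubes_imset.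
move=> _ /imsetP[J + ->]; rewrite inE => /aP[a1 aC].
by split=> //; exists (a J) => //; apply: cube_id.
Qed.

Theorem theorem3p4 (n : nat) (C : {set point n}) (hC : C != set0) :
  is_least (close_cube_condition C) (min_closure_vc_dim C).
Proof.
rewrite /min_closure_vc_dim; case: arg_minnP => // o _ omin.
(* The condition at [k] says that some origin attains a value at most [k], so the least such [k] is
   the minimum over origins. *)
split=> [|k /close_cubeP[o' o'k]]; first by apply/close_cubeP; exists o.
exact: leq_trans (omin o' isT) o'k.
Qed.
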